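(* Let $R$ be a $\mathbb{Q}$-domain, $n=2$, and $D$ a triangular derivation of $R[x_1,x_2]$ over $R$ with $D(x_1)=a$ and $D(x_2)=\sum_{i=0}^l b_ix_1^i$, where $l\ge0$, $a,b_0,\dots,b_l\in R$, $a\ne0$, $b_l\neq0$. Let $I=\{i\in\{0,\dots,l\}: b_i\notin aR\}$ and $f\in\ker D\setminus R$. Then $\exp fD\in\mathrm{T}(R,\mathbf{x})$ if and only if (1) $I=\emptyset$, or (2) $I=\{0\}$, and $b_0/a\in V(R)$ or $\deg_{x_2}f=1$. In particular, if $V(R)=K^\times$, then $\exp fD\in\mathrm{T}(R,\mathbf{x})$ if and only if $b_i\in aR$ for $i=1,\dots,l$.
   Context: $K$ is the field of fractions of $R$; $V(R)$ is the set of $\alpha/\beta\in K^\times$ with $\alpha,\beta\in R\setminus\{0\}$, $\alpha R+\beta R=R$. $\exp D(f)=\sum_{l\ge0}D^l(f)/l!$. $\mathrm{T}(R,\mathbf{x})$ is the subgroup of $\mathrm{Aut}(R[\mathbf{x}]/R)$ generated by affine automorphisms ($\deg\phi(x_i)=1$) and elementary automorphisms (fixing all variables but one). *)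

(* Defs.v *)
From HB Require Import structures.
From mathcomp Require Import all_boot all_order all_algebra.
From mathcomp Require Import mpoly.
Set Implicit Arguments.
Unset Strict Implicit.
Unset Printing Implicit Defensive.
Import Order.TTheory GRing.Theory.
Local Open Scope ring_scope.

Section Defs.
Variable R : idomainType.

Definition x1 : 'I_2 := ord0.
Definition x2 : 'I_2 := ord_max.

Definition endo := {mpoly R[2]} -> {mpoly R[2]}.

Definition subst_endo (t : 'I_2 -> {mpoly R[2]}) : endo :=
  fun p => p \mPo [tuple t i | i < 2].

Definition affine_aut (phi : endo) : Prop :=
  exists t : 'I_2 -> {mpoly R[2]},
    (forall i, msize (t i) = 2%N) /\ phi =1 subst_endo t /\ bijective phi.

Definition elementary_aut (phi : endo) : Prop :=
  exists (i : 'I_2) (t : 'I_2 -> {mpoly R[2]}),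
    (forall j, j != i -> t j = 'X_j) /\ phi =1 subst_endo t /\ bijective phi.

Inductive tame : endo -> Prop :=
  | tame_id : tame id
  | tame_affine phi : affine_aut phi -> tame phi
  | tame_elem phi : elementary_aut phi -> tame phi
  | tame_comp g h : tame g -> tame h -> tame (g \o h)
  | tame_inv g h : tame g -> cancel g h -> cancel h g -> tame h
  | tame_ext g h : tame g -> g =1 h -> tame h.

Definition Dtri (a : R) (b : nat -> R) (l : nat) (p : {mpoly R[2]}) : {mpoly R[2]} :=
  p^`M(x1) * a%:MP + p^`M(x2) * \sum_(i < l.+1) (b i)%:MP * 'X_x1 ^+ i.

(* exp(fD)(p) = sum_{k >= 0} (fD)^k(p)/k!.  The series is finite: for f in
   ker D, (fD)^k p = f^k D^k p, and D strictly lowers the weighted degree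
   (weights 1 for x1, l+1 for x2), so all terms with
   k >= (l+1)*msize p + 1 vanish; we sum up to that bound. *)
Definition expfD (a : R) (b : nat -> R) (l : nat) (f : {mpoly R[2]}) : endo :=
  fun p => \sum_(k < ((l.+1) * msize p).+1)
             ((k`!)%:R)^-1 *: iter k (fun q => f * Dtri a b l q) p.

Definition in_aR (a x : R) : Prop := exists c, x = a * c.

(* x/y (y <> 0) belongs to V(R) = { alpha/beta : alpha,beta in R\{0},
   alpha R + beta R = R }; x/y = alpha/beta in K iff x*beta = y*alpha. *)
Definition inV (x y : R) : Prop :=
  exists alpha beta : R, [/\ alpha != 0, beta != 0, x * beta = y * alpha &
    exists u v : R, u * alpha + v * beta = 1].

Definition V_is_Kx : Prop :=
  forall x y : R, x != 0 -> y != 0 -> inV x y.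

Definition deg_x2 (f : {mpoly R[2]}) : nat :=
  \max_(m <- msupp f) m x2.

End Defs.

(* Main.v *)
(* Let Q be the antiderivative of sum b_i x1^i with Q(0) = 0.  Over K the
   kernel of D is K[g] with g = a x2 - Q(x1), and phi = exp fD maps x1 to
   F1 = x1 + a f and satisfies a F2 = g + Q(F1) because it fixes g.

   A tame pair of polynomials is either affine or of the form
   A(G1, G2 + p(G1)) with A affine, deg p >= 2, deg G2 <= deg G1.  Hence if
   deg F1 < deg F2, some p in R[t] makes deg (F2 - p(F1)) <= deg F1; for l >= 1
   this forces deg (Q - a p) <= 1, i.e. a divides b_1, ..., b_l.

   If a also divides b_0, then Q = a P, and the change of variables below (with
   b_0 replaced by 0) makes phi elementary.  Otherwise Q = a P + b_0 t, and
   conjugation by x2 |-> x2 + P(x1) turns phi into the shear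
   (x1 + a f', x2 + b_0 f') with f' a polynomial in a x2 - b_0 x1 whose degree
   is deg_x2 f.  If this degree is 1 the shear is affine.  Otherwise its
   tameness yields a unimodular row (u, v) lowering the degree of u F1 + v F2,
   so u a + v b_0 = 0 and b_0 / a lies in V(R).  Conversely, such a row provides
   linear coordinates in which the shear is elementary. *)

Require Import Defs.
From HB Require Import structures.
From mathcomp Require Import all_boot all_order all_algebra.
From mathcomp Require Import mpoly.
From mathcomp Require Import ring.
From Stdlib Require Import Classical.
Import Order.TTheory GRing.Theory.
Local Open Scope ring_scope.
Set Implicit Arguments.
Unset Strict Implicit.
Unset Printing Implicit Defensive.

(** * Algebra endomorphisms of [R[x1, x2]] *)

Lemma mpoly_alg_ind n (R : comNzRingType) (P : {mpoly R[n]} -> Prop) :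
    (forall c, P c%:MP) -> (forall i, P 'X_i) ->
    (forall p q, P p -> P q -> P (p + q)) ->
    (forall p q, P p -> P q -> P (p * q)) -> forall p, P p.
Proof.
move=> PC PX PD PM; elim/mpolyind => [|c m p _ _ Pp].
  by rewrite -(mpolyC0 n); apply: PC.
apply: PD => //; rewrite -mul_mpolyC; apply: (PM) => //.
rewrite mpolyXE_id; apply: big_ind => // [|i _].
  by rewrite -mpolyC1; apply: PC.
by elim: (m i) => [|k IH]; rewrite ?expr0 -?mpolyC1 // exprS; apply: PM.
Qed.

Section TwoVariables.
Variable R : idomainType.
Local Notation A := {mpoly R[2]}.
Local Notation X1 := ('X_x1 : A).
Local Notation X2 := ('X_x2 : A).
Local Notation sub2 F1 F2 := (comp_mpoly [tuple F1; F2]).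

Lemma ord2P (P : 'I_2 -> Prop) : P x1 -> P x2 -> forall i, P i.
Proof.
move=> P1 P2 i; have [->//|->//] : i = x1 \/ i = x2.
by case: i => [[|[|//]] lti]; [left | right]; apply: val_inj.
Qed.

(** A predicate on bare functions, because [tame] and [expfD] concern maps that carry no morphism
    structure. *)
Definition alg_endo (phi : A -> A) : Prop :=
  [/\ forall c, phi c%:MP = c%:MP, {morph phi : p q / p + q}
    & {morph phi : p q / p * q}].

Lemma alg_endo_sub2 (F1 F2 : A) : alg_endo (sub2 F1 F2).
Proof. by split=> [c|p q|p q]; rewrite ?comp_mpolyC ?rmorphD ?rmorphM. Qed.

Lemma sub2_X1 (F1 F2 : A) : sub2 F1 F2 X1 = F1.
Proof. by rewrite comp_mpolyXU. Qed.

Lemma sub2_X2 (F1 F2 : A) : sub2 F1 F2 X2 = F2.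
Proof. by rewrite comp_mpolyXU. Qed.

Lemma alg_endo_ext phi psi : alg_endo phi -> alg_endo psi ->
  phi X1 = psi X1 -> phi X2 = psi X2 -> phi =1 psi.
Proof.
move=> [fC fD fM] [gC gD gM] e1 e2; elim/mpoly_alg_ind => [c|i|p q IHp IHq|p q IHp IHq].
- by rewrite fC gC.
- by elim/ord2P: i.
- by rewrite fD gD IHp IHq.
- by rewrite fM gM IHp IHq.
Qed.

Lemma alg_endo_comp phi psi :
  alg_endo phi -> alg_endo psi -> alg_endo (phi \o psi).
Proof.
by move=> [fC fD fM] [gC gD gM]; split=> [c|p q|p q] /=;
  rewrite ?gC ?gD ?gM ?fC ?fD ?fM.
Qed.

Lemma alg_endo_eq phi psi : phi =1 psi -> alg_endo phi -> alg_endo psi.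
Proof. by move=> e [fC fD fM]; split=> [c|p q|p q]; rewrite -!e. Qed.

Lemma alg_endo_can phi psi :
  alg_endo phi -> cancel phi psi -> cancel psi phi -> alg_endo psi.
Proof.
move=> [fC fD fM] K L; split=> [c|p q|p q]; apply: (can_inj K).
- by rewrite L fC.
- by rewrite fD !L.
- by rewrite fM !L.
Qed.

Lemma alg_endo0 phi : alg_endo phi -> phi 0 = 0.
Proof. by move=> [fC _ _]; rewrite -(mpolyC0 2) fC. Qed.

Lemma alg_endoN phi p : alg_endo phi -> phi (- p) = - phi p.
Proof.
by move=> [fC _ fM]; rewrite -mulN1r fM -mpolyC1 -mpolyCN fC mpolyCN mulN1r.
Qed.

Lemma alg_endoB phi p q : alg_endo phi -> phi (p - q) = phi p - phi q.
Proof. by move=> h; have [_ fD _] := h; rewrite fD alg_endoN. Qed.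

Lemma alg_endo_horner phi (G : A) (p : {poly R}) : alg_endo phi ->
  phi (horner_alg G p) = horner_alg (phi G) p.
Proof.
move=> h; have [fC fD fM] := h.
elim/poly_ind: p => [|p c IH]; first by rewrite !rmorph0 alg_endo0.
by rewrite !rmorphD !rmorphM /= !horner_algX !horner_algC fD fM IH alg_mpolyC fC.
Qed.

Lemma alg_endoE phi : alg_endo phi -> phi =1 sub2 (phi X1) (phi X2).
Proof.
by move=> h; apply: alg_endo_ext => //; [apply: alg_endo_sub2 | rewrite sub2_X1 | rewrite sub2_X2].
Qed.

Lemma subst_endoE (t : 'I_2 -> A) : subst_endo t =1 sub2 (t x1) (t x2).
Proof.
move=> p; rewrite /subst_endo; congr (_ \mPo _).
by apply/eq_from_tnth; elim/ord2P; rewrite tnth_mktuple.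
Qed.

Lemma subst_endo_alg (t : 'I_2 -> A) : alg_endo (subst_endo t).
Proof. exact: (alg_endo_eq (fsym (subst_endoE t)) (alg_endo_sub2 _ _)). Qed.

Lemma subst_endo_X (t : 'I_2 -> A) i : subst_endo t 'X_i = t i.
Proof.
by rewrite subst_endoE; elim/ord2P: i; rewrite ?sub2_X1 ?sub2_X2.
Qed.

Definition pairf (F1 F2 : A) (i : 'I_2) : A := if i == x1 then F1 else F2.

Lemma alg_endo_pairf phi : alg_endo phi -> phi =1 subst_endo (pairf (phi X1) (phi X2)).
Proof. by move=> h p; rewrite alg_endoE // subst_endoE. Qed.

(** * Derivations and the chain rule *)

Definition derivation (d : A -> A) : Prop :=
  [/\ forall c, d c%:MP = 0, {morph d : p q / p + q}
    & forall p q, d (p * q) = d p * q + p * d q].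

Lemma mderiv_derivation i : derivation (mderiv i).
Proof. by split=> [c|p q|p q]; rewrite ?mderivC ?mderivD ?mderivM. Qed.

Lemma mderivU (i j : 'I_2) : mderiv i ('X_j : A) = (i == j)%:R.
Proof.
rewrite mderivX mnm1E eq_sym; have [->|_] := eqVneq; last by rewrite scale0r.
by rewrite scale1r -mpolyX0; congr ('X_[_]); apply/mnmP => k; rewrite mnmBE subnn mnm0E.
Qed.

(** Both sides are additive in [p] and satisfy the Leibniz rule along [phi], so constants and
    variables suffice. With [p] the image of a variable under the inverse of [phi], this yields
    Jacobian identities. *)
Lemma chain_rule d phi p : derivation d -> alg_endo phi ->
  d (phi p) = phi (mderiv x1 p) * d (phi X1) + phi (mderiv x2 p) * d (phi X2).
Proof.
move=> [dC dD dM] h; have [fC fD fM] := h.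
elim/mpoly_alg_ind: p => [c|i|p q IHp IHq|p q IHp IHq].
- by rewrite fC dC !mderivC alg_endo0 // !mul0r addr0.
- have [e0 e1] : phi 0 = 0 /\ phi 1 = 1 by rewrite alg_endo0 // -mpolyC1 fC.
  by elim/ord2P: i; rewrite !mderivU /= e0 e1; ring.
- by rewrite !mderivD !fD dD IHp IHq; ring.
- by rewrite fM dM !mderivM !fD !fM IHp IHq; ring.
Qed.

(** * Sizes *)

Lemma msizeD_lt (p q : A) : (msize q < msize p)%N -> msize (p + q) = msize p.
Proof.
move=> lt; apply/eqP; rewrite eqn_leq; apply/andP; split.
  by rewrite (leq_trans (msizeD_le _ _)) // geq_max leqnn ltnW.
have := msizeD_le (p + q) (- q); rewrite addrK msizeN leq_max => /orP[//|].
by rewrite leqNgt lt.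
Qed.

Lemma msize_leD (p q : A) k : (msize p <= k)%N -> (msize q <= k)%N ->
  (msize (p + q) <= k)%N.
Proof. by move=> ? ?; rewrite (leq_trans (msizeD_le _ _)) // geq_max; apply/andP. Qed.

Lemma msizeCM (c : R) (p : A) : c != 0 -> msize (c%:MP * p) = msize p.
Proof. by move=> c0; rewrite mul_mpolyC msizeZ. Qed.

Lemma msizeCM_le (c : R) (p : A) : (msize (c%:MP * p) <= msize p)%N.
Proof. by rewrite mul_mpolyC msizeZ_le. Qed.

Lemma msizeC_le1 (c : R) : (msize (c%:MP : A) <= 1)%N.
Proof. by rewrite msizeC; case: (_ == _). Qed.

(** Over a domain the powers of a nonconstant [G] have distinct degrees, so the top one cannot
    cancel; [msize] is the total degree plus one. *)
Lemma msize_horner (G : A) (p : {poly R}) : (1 < msize G)%N -> p != 0 ->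
  msize (horner_alg G p) = ((size p).-1 * (msize G).-1).+1.
Proof.
move=> G1; have G0 : G != 0 by rewrite -msize_poly_eq0 -lt0n ltnW.
elim/poly_ind: p => [|p c IH]; first by rewrite eqxx.
rewrite rmorphD rmorphM /= horner_algX horner_algC alg_mpolyC size_MXaddC.
have [-> /=|p0 _] := eqVneq p 0.
  rewrite rmorph0 !mul0r !add0r polyC_eq0 => c0.
  by rewrite msizeC c0 ?eqxx /= (negbTE c0) size_poly0.
have e := IH p0; rewrite /=.
have hp : horner_alg G p != 0 by rewrite -msize_poly_eq0 e.
have eM : msize (horner_alg G p * G) = ((size p) * (msize G).-1).+1.
  rewrite msizeM // e addSn /=; move: G1 p0; rewrite -size_poly_gt0.
  by case: (msize G) (size p) => [|m] [|k] // _ _; rewrite mulSn addnS addnC.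
rewrite msizeD_lt eM // (leq_ltn_trans (msizeC_le1 _)) // ltnS muln_gt0.
by rewrite size_poly_gt0 p0 -ltnS prednK ?(ltnW G1).
Qed.

Lemma msize_U i : msize ('X_i : A) = 2%N.
Proof. by rewrite msizeX mdeg1. Qed.

Lemma msize_lin (u v c : R) : (u != 0) || (v != 0) ->
  msize (u%:MP * X1 + v%:MP * X2 + c%:MP) = 2%N.
Proof.
move=> uv; apply/eqP; rewrite eqn_leq; apply/andP; split.
  rewrite !msize_leD // ?(leq_trans (msizeC_le1 _)) //.
    by rewrite (leq_trans (msizeCM_le _ _)) ?msize_U.
  by rewrite (leq_trans (msizeCM_le _ _)) ?msize_U.
rewrite ltnNge; apply/negP => /msize1_polyC e.
have e1 := congr1 (mderiv x1) e; have e2 := congr1 (mderiv x2) e.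
move: e1 e2; rewrite !mderivD !mderivM !mderivC !mderivU /= !(mul0r, mulr0, add0r, addr0, mulr1).
move=> /eqP; rewrite mpolyC_eq0 => /eqP u0 /eqP; rewrite mpolyC_eq0 => /eqP v0.
by move: uv; rewrite u0 v0 eqxx.
Qed.

(** * Reduced pairs *)

(* The pairs are described recursively, not as words in generators: when an
   elementary step cancels the previous one, [G1, G2] is again available as a
   reduced pair, so this class is stable under all affine and elementary steps. *)
Inductive reduced : A -> A -> Prop :=
  | reduced_affine (al be ga de c d : R) : al * de - be * ga \is a GRing.unit ->
      reduced (al%:MP * X1 + be%:MP * X2 + c%:MP) (ga%:MP * X1 + de%:MP * X2 + d%:MP)
  | reduced_step (G1 G2 : A) (p : {poly R}) (al be ga de c d : R) :
      reduced G1 G2 -> (1 < msize G1)%N -> (msize G2 <= msize G1)%N ->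
      (2 < size p)%N -> al * de - be * ga \is a GRing.unit ->
      reduced (al%:MP * G1 + be%:MP * (G2 + horner_alg G1 p) + c%:MP)
              (ga%:MP * G1 + de%:MP * (G2 + horner_alg G1 p) + d%:MP).

Lemma reduced_eq F1 F2 G1 G2 : reduced F1 F2 -> F1 = G1 -> F2 = G2 -> reduced G1 G2.
Proof. by move=> h <- <-. Qed.

(** The outer affine layer absorbs a further one, the determinant being multiplicative. *)
Lemma reduced_aff F1 F2 (al be ga de c d : R) :
  al * de - be * ga \is a GRing.unit -> reduced F1 F2 ->
  reduced (al%:MP * F1 + be%:MP * F2 + c%:MP) (ga%:MP * F1 + de%:MP * F2 + d%:MP).
Proof.
move=> U [al' be' ga' de' c' d' U'|G1 G2 p al' be' ga' de' c' d' r g1 g2 p2 U'].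
  apply: (reduced_eq (@reduced_affine (al * al' + be * ga') (al * be' + be * de')
    (ga * al' + de * ga') (ga * be' + de * de') (al * c' + be * d' + c) (ga * c' + de * d' + d) _)).
  - have -> : (al * al' + be * ga') * (ga * be' + de * de') -
     (al * be' + be * de') * (ga * al' + de * ga')
      = (al * de - be * ga) * (al' * de' - be' * ga') by ring.
    by rewrite unitrM U U'.
  - by ring.
  - by ring.
apply: (reduced_eq (@reduced_step G1 G2 p (al * al' + be * ga') (al * be' + be * de')
    (ga * al' + de * ga') (ga * be' + de * de') (al * c' + be * d' + c) (ga * c' + de * d' + d)
    r g1 g2 p2 _)).
- have -> : (al * al' + be * ga') * (ga * be' + de * de') -
     (al * be' + be * de') * (ga * al' + de * ga')
      = (al * de - be * ga) * (al' * de' - be' * ga') by ring.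
  by rewrite unitrM U U'.
- by ring.
- by ring.
Qed.

Lemma horner_alg_lin (G : A) (q : {poly R}) : (size q <= 2)%N ->
  horner_alg G q = (q`_1)%:MP * G + (q`_0)%:MP.
Proof.
move=> q2; have {1}-> : q = (q`_1)%:P * 'X + (q`_0)%:P.
  apply/polyP => -[|[|i]]; rewrite coefD coefMX !coefC /= ?add0r ?addr0 //.
  by rewrite nth_default // (leq_trans q2).
by rewrite rmorphD rmorphM /= horner_algX !horner_algC !alg_mpolyC.
Qed.

Lemma horner_alg_comp (G : A) (p q : {poly R}) :
  horner_alg G (p \Po q) = horner_alg (horner_alg G q) p.
Proof.
elim/poly_ind: p => [|p c IH]; first by rewrite comp_poly0 !rmorph0.
by rewrite comp_poly_MXaddC !rmorphD !rmorphM /= !horner_algC horner_algX IH.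
Qed.

Lemma horner_alg_affine (G : A) (u v : R) :
  horner_alg G (u%:P * 'X + v%:P) = u%:MP * G + v%:MP.
Proof. by rewrite rmorphD rmorphM /= horner_algX !horner_algC !alg_mpolyC. Qed.

Lemma unit_det_row1 (al be ga de : R) : al * de - be * ga \is a GRing.unit ->
  (al != 0) || (be != 0).
Proof.
apply: contraLR; rewrite negb_or !negbK => /andP[/eqP -> /eqP ->].
by rewrite !mul0r subrr unitr0.
Qed.

Lemma unit_det_row2 (al be ga de : R) : al * de - be * ga \is a GRing.unit ->
  (ga != 0) || (de != 0).
Proof.
move=> U; apply: (@unit_det_row1 ga de (- al) (- be)).
by have -> : ga * - be - de * - al = al * de - be * ga by ring.
Qed.

Lemma msize_comb (G H : A) (u v c : R) : v != 0 -> (msize G < msize H)%N ->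
  (1 < msize H)%N -> msize (u%:MP * G + v%:MP * H + c%:MP) = msize H.
Proof.
move=> v0 GH H1; rewrite -addrA addrCA msizeD_lt msizeCM //.
case: (msize H) GH H1 => // k; rewrite !ltnS => GH H1.
by rewrite msize_leD // ?(leq_trans (msizeCM_le _ _)) // (leq_trans (msizeC_le1 _)).
Qed.

Lemma msize_comb_le (G H : A) (u v c : R) k : (msize G <= k)%N -> (msize H <= k)%N ->
  (0 < k)%N -> (msize (u%:MP * G + v%:MP * H + c%:MP) <= k)%N.
Proof.
move=> Gk Hk k0; rewrite !msize_leD // ?(leq_trans (msizeC_le1 _)) //.
  by rewrite (leq_trans (msizeCM_le _ _)).
by rewrite (leq_trans (msizeCM_le _ _)).
Qed.

(** As [p] has degree at least 2, [p(G1)] exceeds the degree of [G1] and so dominates [G2]. *)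
Lemma msize_step (G1 G2 : A) (p : {poly R}) : (1 < msize G1)%N ->
  (msize G2 <= msize G1)%N -> (2 < size p)%N ->
  (msize G1 < msize (G2 + horner_alg G1 p))%N.
Proof.
move=> g1 g2 p2; have p0 : p != 0 by rewrite -size_poly_gt0 (leq_trans _ p2).
have lt : (msize G1 < msize (horner_alg G1 p))%N.
  rewrite msize_horner //.
  case: (msize G1) (size p) g1 p2 => [|[|m]] [|[|[|k]]] // _ _.
  by rewrite [k.+3.-1]/= [m.+2.-1]/= 2!mulSn !addSn addnS !ltnS leq_addr.
by rewrite addrC msizeD_lt // (leq_ltn_trans g2).
Qed.

(** The new step is affine, or sits on top of the pair, or merges with the last step; a merger may
    cancel that step, and then the previous reduced pair reappears. *)
Lemma reduced_add_horner (F1 F2 : A) (q : {poly R}) :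
  reduced F1 F2 -> reduced F1 (F2 + horner_alg F1 q).
Proof.
move=> h; have [q2|q2] := leqP (size q) 2.
  rewrite horner_alg_lin //.
  apply: (reduced_eq (@reduced_aff _ _ 1 0 q`_1 1 0 q`_0 _ h)); [|by ring|by ring].
  by have -> : 1 * 1 - 0 * q`_1 = 1 :> R; [ring | rewrite unitr1].
have big (G1 G2 : A) : reduced G1 G2 -> (1 < msize G1)%N -> (msize G2 <= msize G1)%N ->
    reduced G1 (G2 + horner_alg G1 q).
  move=> r g1 g2.
  apply: (reduced_eq (@reduced_step _ _ q 1 0 0 1 0 0 r g1 g2 q2 _)); [|by ring|by ring].
  by have -> : 1 * 1 - 0 * 0 = 1 :> R; [ring | rewrite unitr1].
case: F1 F2 / h (h) => [al be ga de c d U r|G1 G2 p al be ga de c d rG g1 g2 p2 U r].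
  by apply: (big) => //; rewrite !msize_lin ?(unit_det_row1 U) ?(unit_det_row2 U).
(* If [be] is nonzero, the first component already has the top degree and [big] applies; otherwise
   it is affine in [G1] and the two steps merge. *)
have lt := msize_step g1 g2 p2; have [b0|b0] := eqVneq be 0; last first.
  have e1 := msize_comb al c b0 lt (ltn_trans g1 lt).
  apply: (big) => //; rewrite e1 ?(ltn_trans g1) //.
  by rewrite msize_comb_le // ?(ltnW lt) // (leq_trans _ lt).
have [Ua Ud] : al \is a GRing.unit /\ de \is a GRing.unit.
  by move: U; rewrite b0 mul0r subr0 unitrM => /andP.
(* The term [q(al G1 + c)] moves inside the bracket multiplied by [de], whence the factor
   [de^-1]. *)
set p' := p + de^-1%:P * (q \Po (al%:P * 'X + c%:P)).
have e1 : al%:MP * G1 + be%:MP * (G2 + horner_alg G1 p) + c%:MP = al%:MP * G1 + c%:MP :> A.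
  by rewrite b0; ring.
have e2 : ga%:MP * G1 + de%:MP * (G2 + horner_alg G1 p) + d%:MP + horner_alg (al%:MP * G1 + c%:MP) q
    = ga%:MP * G1 + de%:MP * (G2 + horner_alg G1 p') + d%:MP.
  rewrite /p' rmorphD rmorphM /= horner_algC alg_mpolyC horner_alg_comp horner_alg_affine.
  rewrite -addrA (addrC d%:MP) addrA; congr (_ + _).
  rewrite -addrA; congr (_ + _); rewrite !mulrDr mulrA -mpolyCM divrr // mpolyC1 mul1r.
  by rewrite addrA.
rewrite e1 e2; have [q2'|q2'] := leqP (size p') 2; last first.
  apply: (reduced_eq (@reduced_step _ _ p' al 0 ga de c d rG g1 g2 q2' _)); [|by ring|by ring].
  by rewrite mul0r subr0 unitrM Ua Ud.
rewrite horner_alg_lin //.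
apply: (reduced_eq (@reduced_aff _ _ al 0 (ga + de * p'`_1) de c (d + de * p'`_0) _ rG));
  [|by ring|by ring].
by rewrite mul0r subr0 unitrM Ua Ud.
Qed.

(** * Tame endomorphisms preserve reduced pairs *)

(** Quantifying over all reduced pairs, and not only [X1], [X2], makes the property stable under
    composition: the outer map acts first on the pair. *)
Definition preserves_reduced (phi : A -> A) : Prop :=
  alg_endo phi /\
  forall F1 F2, reduced F1 F2 -> reduced (sub2 F1 F2 (phi X1)) (sub2 F1 F2 (phi X2)).

Lemma preserves_reduced_comp phi psi :
  preserves_reduced phi -> preserves_reduced psi -> preserves_reduced (phi \o psi).
Proof.
move=> [fA fP] [gA gP]; split=> [|F1 F2 r]; first exact: alg_endo_comp.
have e p : sub2 F1 F2 (phi p) = sub2 (sub2 F1 F2 (phi X1)) (sub2 F1 F2 (phi X2)) p.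
  exact: (alg_endoE (alg_endo_comp (alg_endo_sub2 F1 F2) fA)).
by rewrite /= (e (psi X1)) (e (psi X2)); apply/gP/fP.
Qed.

Lemma preserves_reduced_eq phi psi :
  phi =1 psi -> preserves_reduced phi -> preserves_reduced psi.
Proof.
move=> e [fA fP]; split=> [|F1 F2 r]; first exact: alg_endo_eq fA.
by rewrite -!e; apply: fP.
Qed.

Lemma preserves_reduced_aff phi (al be ga de c d : R) : alg_endo phi ->
  al * de - be * ga \is a GRing.unit ->
  phi X1 = al%:MP * X1 + be%:MP * X2 + c%:MP ->
  phi X2 = ga%:MP * X1 + de%:MP * X2 + d%:MP -> preserves_reduced phi.
Proof.
move=> h U e1 e2; split=> // F1 F2 r; rewrite e1 e2 !rmorphD !rmorphM /=.
by rewrite !comp_mpolyC sub2_X1 sub2_X2; apply: reduced_aff.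
Qed.

(** The inverse is carried along because [tame_inv] allows inverting any tame map. *)
Definition bipreserving (phi : A -> A) : Prop := exists psi,
  [/\ cancel phi psi, cancel psi phi, preserves_reduced phi & preserves_reduced psi].

Lemma bipreserving_comp phi psi :
  bipreserving phi -> bipreserving psi -> bipreserving (phi \o psi).
Proof.
move=> [f' [fK f'K fP f'P]] [g' [gK g'K gP g'P]]; exists (g' \o f').
by split; [exact: can_comp | exact: can_comp | exact: preserves_reduced_comp
  | exact: preserves_reduced_comp].
Qed.

Lemma bipreserving_eq phi psi : phi =1 psi -> bipreserving phi -> bipreserving psi.
Proof.
move=> e [f' [fK f'K fP f'P]]; exists f'; split=> //.
- by move=> x; rewrite -e.
- by move=> x; rewrite -e.
- exact: preserves_reduced_eq fP.
Qed.

Lemma preserves_reduced_id : preserves_reduced id.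
Proof. by split=> // F1 F2; rewrite sub2_X1 sub2_X2. Qed.

Lemma sub2_swapK : cancel (sub2 X2 X1) (sub2 X2 X1).
Proof.
apply: (@alg_endo_ext (sub2 X2 X1 \o sub2 X2 X1) id) => //.
- exact: (alg_endo_comp (alg_endo_sub2 _ _) (alg_endo_sub2 _ _)).
- by rewrite /= sub2_X1 sub2_X2.
- by rewrite /= sub2_X2 sub2_X1.
Qed.

(** Exchanging the variables is affine; this reduces elementary maps that change [x1] to those that
    change [x2]. *)
Lemma bipreserving_swap (phi : A -> A) :
  bipreserving (sub2 X2 X1 \o phi \o sub2 X2 X1) -> bipreserving phi.
Proof.
have K := sub2_swapK.
have S : bipreserving (sub2 X2 X1).
  have P : preserves_reduced (sub2 X2 X1).
    apply: (@preserves_reduced_aff _ 0 1 1 0 0 0); first exact: alg_endo_sub2.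
    - by have -> : 0 * 0 - 1 * 1 = -1 :> R; [ring | rewrite unitrN1].
    - by rewrite sub2_X1; ring.
    - by rewrite sub2_X2; ring.
  by exists (sub2 X2 X1).
move=> h; apply: (bipreserving_eq _ (bipreserving_comp (bipreserving_comp S h) S)).
by move=> x /=; rewrite !K.
Qed.

Lemma preserves_reduced_elem phi (u : R) (q : {poly R}) : alg_endo phi ->
  u \is a GRing.unit -> phi X1 = X1 -> phi X2 = u%:MP * X2 + horner_alg X1 q ->
  preserves_reduced phi.
Proof.
move=> h U e1 e2; split=> // F1 F2 r; rewrite e1 e2 rmorphD rmorphM /=.
rewrite comp_mpolyC (alg_endo_horner _ _ (alg_endo_sub2 F1 F2)) !sub2_X1 sub2_X2.
apply: reduced_add_horner.
apply: (reduced_eq (@reduced_aff _ _ 1 0 0 u 0 0 _ r)); [|by ring|by ring].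
by rewrite mul0r subr0 mul1r.
Qed.

Lemma mpolyC_inj : injective (@mpolyC 2 R).
Proof. by move=> c d /(congr1 (mcoeff 0%MM)); rewrite !mcoeffC eqxx !mulr1. Qed.

(** The degrees add up to zero, so both factors are constants. *)
Lemma mpoly_mul_eq1 (p q : A) : p * q = 1 -> exists2 u : R, u \is a GRing.unit & p = u%:MP.
Proof.
move=> e; have pq0 : p * q != 0 by rewrite e oner_eq0.
have /andP[p0 q0] : (p != 0) && (q != 0) by rewrite -negb_or -mulf_eq0.
have s := msizeM p0 q0; rewrite e msize1 in s.
have [p1 q1] : (msize p <= 1)%N /\ (msize q <= 1)%N.
  move: p0 q0 s; rewrite -!msize_poly_eq0.
  case: (msize p) (msize q) => [|[|k]] [|[|m]] //=; by rewrite ?addnS ?addSn.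
move: e; rewrite (msize1_polyC p1) (msize1_polyC q1) -mpolyCM -mpolyC1 => /mpolyC_inj e.
by exists p@_0 => //; apply/unitrPr; exists q@_0.
Qed.

(** In characteristic zero no monomial containing [x2] is killed by the derivative; [q] collects the
    remaining ones, powers of [x1]. *)
Lemma mderiv2_eq0 (g : A) : (forall n : nat, (n.+1%:R : R) != 0) -> mderiv x2 g = 0 ->
  exists q : {poly R}, g = horner_alg X1 q.
Proof.
move=> h0 e; exists (\sum_(m <- msupp g) g@_m *: 'X^(m x1)).
rewrite {1}(mpolyE g) rmorph_sum /=; apply: eq_big_seq => m mg.
rewrite linearZ /= rmorphXn /= horner_algX mulr_algl; congr (_ *: _).
rewrite mpolyXE_id !big_ord_recl big_ord0 mulr1.
have -> : lift ord0 ord0 = x2 by apply: val_inj.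
have -> : m x2 = 0%N; last by rewrite expr0 mulr1.
apply/eqP/negPn/negP; rewrite -lt0n => m2.
have em : m = (m - U_(x2) + U_(x2))%MM.
  by rewrite submK // lep1mP -lt0n.
have := congr1 (mcoeff (m - U_(x2))%MM) e; rewrite mcoeff_mderiv -em mcoeff0.
move/eqP; rewrite -mulr_natr mulf_eq0 (negbTE (h0 _)) orbF.
by apply/negP; rewrite mcoeff_msupp in mg.
Qed.

(* By the chain rule the x2-derivative of [phi X2] is invertible, hence constant. *)
Lemma bipreserving_elem phi : (forall n : nat, (n.+1%:R : R) != 0) ->
  alg_endo phi -> bijective phi -> phi X1 = X1 -> bipreserving phi.
Proof.
move=> h0 h [psi K L] e1; have h' := alg_endo_can h K L.
have [d0 d1] : mderiv x2 X1 = 0 :> A /\ mderiv x2 X2 = 1 :> A by rewrite !mderivU.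
have := chain_rule (psi X2) (mderiv_derivation x2) h.
rewrite L e1 d0 mulr0 add0r d1 mulrC => /esym/mpoly_mul_eq1[u U eu].
have [q eq] : exists q, phi X2 - u%:MP * X2 = horner_alg X1 q.
  apply: mderiv2_eq0 => //; rewrite mderivB mderivM mderivC d1 eu; by ring.
have {eq} e2 : phi X2 = u%:MP * X2 + horner_alg X1 q by rewrite -eq addrC subrK.
have e1' : psi X1 = X1 by rewrite -{1}e1 K.
exists psi; split=> //; first exact: preserves_reduced_elem e1 e2.
apply: (@preserves_reduced_elem _ u^-1 (- (u^-1%:P * q))) => //; first by rewrite unitrV.
have := congr1 psi e2; have [fC fD fM] := h'.
rewrite K fD fM fC (alg_endo_horner _ _ h') e1' rmorphN rmorphM /= horner_algC alg_mpolyC.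
move=> e; rewrite {2}e mulrDr mulrA -mpolyCM mulVr // mpolyC1; by ring.
Qed.

Lemma msize_le2 (p : A) : (msize p <= 2)%N ->
  exists u v c : R, p = u%:MP * X1 + v%:MP * X2 + c%:MP.
Proof.
move=> p2; exists p@_(U_(x1))%MM, p@_(U_(x2))%MM, p@_0%MM; apply/mpolyP => m.
rewrite !mcoeffD !mcoeffCM mcoeffC !mcoeffX.
have [m2|m2] := leqP 2 (mdeg m).
  rewrite memN_msupp_eq0 ?msize_mdeg_ge ?(leq_trans p2) //.
  have nU i : ((U_(i))%MM == m) = false by apply/eqP => e; move: m2; rewrite -e mdeg1.
  rewrite !nU; have -> : (m == 0%MM) = false by apply/eqP => e; move: m2; rewrite e mdeg0.
  by rewrite !mulr0 !addr0.
case e : (mdeg m) m2 => [|[|k]] // _.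
  move/eqP: e; rewrite mdeg_eq0 => /eqP ->; rewrite eqxx mulr1.
  have nU i : (U_(i)%MM == 0%MM :> 'X_{1..2}) = false.
    by apply/eqP => /(congr1 mdeg); rewrite mdeg1 mdeg0.
  by rewrite !nU !mulr0 !add0r.
move/eqP/mdeg1P: e => [i /eqP ->].
have -> : (U_(i)%MM == 0%MM :> 'X_{1..2}) = false.
  by apply/eqP => /(congr1 mdeg); rewrite mdeg1 mdeg0.
by elim/ord2P: i; rewrite !eq_mnm1 /= !(mulr1, mulr0, addr0, add0r).
Qed.

(** By the chain rule the determinant of the linear part divides 1, so it is a unit, and Cramer's
    rule makes the inverse affine as well. *)
Lemma bipreserving_affine phi : alg_endo phi -> bijective phi ->
  (msize (phi X1) <= 2)%N -> (msize (phi X2) <= 2)%N -> bipreserving phi.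
Proof.
move=> h [psi K L] /msize_le2[al [be [c e1]]] /msize_le2[ga [de [d e2]]].
have h' := alg_endo_can h K L; have [fC fD fM] := h'.
have D i (u v w : R) :
    mderiv i (u%:MP * X1 + v%:MP * X2 + w%:MP) = u%:MP * (i == x1)%:R + v%:MP * (i == x2)%:R.
  by rewrite !mderivD !mderivM !mderivC !mderivU; ring.
have J i k := chain_rule (psi 'X_k) (mderiv_derivation i) h.
have [J11 J12] := (J x1 x1, J x1 x2); have [J21 J22] := (J x2 x1, J x2 x2).
rewrite !L !e1 !e2 !D !mderivU /= in J11 J12 J21 J22.
have U : al * de - be * ga \is a GRing.unit.
  have : (al * de - be * ga)%:MP * (phi (mderiv x1 (psi X1)) * phi (mderiv x2 (psi X2))
      - phi (mderiv x2 (psi X1)) * phi (mderiv x1 (psi X2))) = 1 * 1 - 0 * 0 :> A.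
    (* Determinants of both sides of the Jacobian identity. *)
    have E := congr2 (fun u v : A => u - v) (congr2 *%R J11 J22) (congr2 *%R J12 J21).
    by apply: etrans (esym E); ring.
  rewrite mulr1 mulr0 subr0.
  by move/mpoly_mul_eq1 => [u Uu /mpolyC_inj ->].
exists psi; split=> //; first exact: preserves_reduced_aff U e1 e2.
have := congr1 psi e1; have := congr1 psi e2.
rewrite !K !fD !fM !fC; set y1 := psi X1; set y2 := psi X2 => s2 s1.
set D0 := al * de - be * ga in U.
have V : (D0^-1)%:MP * (al * de - be * ga)%:MP = 1 :> A by rewrite -mpolyCM mulVr // mpolyC1.
apply: (@preserves_reduced_aff _ (D0^-1 * de) (- (D0^-1 * be)) (- (D0^-1 * ga)) (D0^-1 * al)
   (D0^-1 * (be * d - de * c)) (D0^-1 * (ga * c - al * d))) => //.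
- have -> : D0^-1 * de * (D0^-1 * al) - - (D0^-1 * be) * - (D0^-1 * ga) = D0^-1 * D0^-1 * D0.
    by rewrite /D0; ring.
  by rewrite !unitrM !unitrV U.
- by rewrite -/y1 s1 s2 -[LHS]mul1r -V; ring.
- by rewrite -/y2 s1 s2 -[LHS]mul1r -V; ring.
Qed.

Lemma bipreserving_tame (phi : A -> A) : (forall n : nat, (n.+1%:R : R) != 0) ->
  tame phi -> bipreserving phi.
Proof.
move=> h0; elim=> {phi} [|phi [t [ht [e bij]]]|phi [i [t [ht [e bij]]]]|g h _ IHg _ IHh
    |g h _ [g' [gK g'K gP g'P]] hK h'K|g h _ IH e].
- by exists id; split=> //; apply: preserves_reduced_id.
- have H := alg_endo_eq (fsym e) (subst_endo_alg t).
  by apply: bipreserving_affine => //; rewrite e subst_endo_X ht.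
- have H := alg_endo_eq (fsym e) (subst_endo_alg t).
  elim/ord2P: i ht => ht; last first.
    by apply: bipreserving_elem => //; rewrite e subst_endo_X ht.
  have S := alg_endo_sub2 X2 X1.
  apply: bipreserving_swap; apply: bipreserving_elem => //.
  + exact: (alg_endo_comp (alg_endo_comp S H) S).
  + have SK : cancel (sub2 X2 X1) (sub2 X2 X1) by exact: sub2_swapK.
    have bS : bijective (sub2 X2 X1) by exists (sub2 X2 X1).
    exact: (bij_comp (bij_comp bS bij) bS).
  + by rewrite /= sub2_X1 e subst_endo_X ht // sub2_X2.
- exact: bipreserving_comp.
- exists g; split=> //; apply: preserves_reduced_eq g'P => x.
  by rewrite -{1}[x]h'K gK.
- exact: bipreserving_eq IH.
Qed.

Lemma tame_reduced (phi : A -> A) : (forall n : nat, (n.+1%:R : R) != 0) ->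
  tame phi -> alg_endo phi /\ reduced (phi X1) (phi X2).
Proof.
move=> h0 /(bipreserving_tame h0)[_ [_ _ [h P] _]]; split=> //.
have r : reduced X1 X2.
  apply: (reduced_eq (@reduced_affine 1 0 0 1 0 0 _)); [|by ring|by ring].
  by rewrite mul0r subr0 mulr1 unitr1.
have I : sub2 X1 X2 =1 id.
  by apply: alg_endo_ext; [exact: alg_endo_sub2|by []|exact: sub2_X1|exact: sub2_X2].
by have := P _ _ r; rewrite !I.
Qed.

(** The outer layer must have [be = 0], for otherwise the first component attains the top degree.
    Then [F1] is affine in [G1], and removing [de p(G1)], a polynomial in [F1], leaves an affine
    combination of [G1] and [G2]. *)
Lemma reduced_sub_horner (F1 F2 : A) : reduced F1 F2 -> (msize F1 < msize F2)%N ->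
  exists p : {poly R}, (msize (F2 - horner_alg F1 p) <= msize F1)%N.
Proof.
case=> [al be ga de c d U|G1 G2 p al be ga de c d _ g1 g2 p2 U].
  by rewrite !msize_lin ?(unit_det_row1 U) ?(unit_det_row2 U).
have lt := msize_step g1 g2 p2; have [b0|b0] := eqVneq be 0; last first.
  have e1 := msize_comb al c b0 lt (ltn_trans g1 lt).
  by rewrite e1 ltnNge msize_comb_le // ?(ltnW lt) // (leq_trans _ lt).
move: U; rewrite b0 mul0r subr0 unitrM => /andP[Ua Ud] _.
(* This is [de p] evaluated at [(F1 - c) / al], which equals [G1]. *)
exists (de%:P * (p \Po (al^-1%:P * 'X + (- (al^-1 * c))%:P))).
rewrite rmorphM /= horner_algC alg_mpolyC horner_alg_comp horner_alg_affine.
have V : (al^-1)%:MP * al%:MP = 1 :> A by rewrite -mpolyCM mulVr // mpolyC1.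
have -> : (al^-1)%:MP * (al%:MP * G1 + 0%:MP * (G2 + horner_alg G1 p) + c%:MP) +
    (- (al^-1 * c))%:MP = G1 :> A.
  by rewrite -[RHS]mul1r -V; ring.
have -> : ga%:MP * G1 + de%:MP * (G2 + horner_alg G1 p) + d%:MP - de%:MP * horner_alg G1 p
    = ga%:MP * G1 + de%:MP * G2 + d%:MP by ring.
have -> : al%:MP * G1 + 0%:MP * (G2 + horner_alg G1 p) + c%:MP = al%:MP * G1 + c%:MP :> A.
  by ring.
have a0 : al != 0 by apply: contraTneq Ua => ->; rewrite unitr0.
have -> : msize (al%:MP * G1 + c%:MP) = msize G1.
  by rewrite msizeD_lt msizeCM // (leq_ltn_trans (msizeC_le1 _)).
by rewrite msize_comb_le // ltnW.
Qed.

(** The adjugate row [(de, - be)] of the outer layer eliminates its large component; it is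
    unimodular because the determinant is a unit. *)
Lemma reduced_row (F1 F2 : A) : reduced F1 F2 -> (2 < maxn (msize F1) (msize F2))%N ->
  exists u v u' v' : R, u' * u + v' * v = 1 /\
    (msize (u%:MP * F1 + v%:MP * F2) < maxn (msize F1) (msize F2))%N.
Proof.
case=> [al be ga de c d U|G1 G2 p al be ga de c d _ g1 g2 p2 U].
  by rewrite !msize_lin ?(unit_det_row1 U) ?(unit_det_row2 U).
have lt := msize_step g1 g2 p2; set H := G2 + horner_alg G1 p in lt *.
set F1' := _ + _ + c%:MP; set F2' := _ + _ + d%:MP; set D := al * de - be * ga in U.
move=> m2; exists de, (- be), (al * D^-1), (ga * D^-1); split.
  by rewrite -(mulrV U) /D; ring.
have D0 : D != 0 by apply: contraTneq U => ->; rewrite unitr0.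
(* Cramer's rule expresses [D H] through both components, so one of them is at least as large as
   [H]. *)
have HM : (msize H <= maxn (msize F1') (msize F2'))%N.
  rewrite -(msizeCM _ D0).
  have -> : D%:MP * H = (- ga)%:MP * F1' + al%:MP * F2' + (ga * c - al * d)%:MP.
    by rewrite /F1' /F2' /D; ring.
  by rewrite msize_comb_le ?leq_maxl ?leq_maxr // (leq_trans _ m2).
apply: leq_trans HM; apply: leq_ltn_trans lt.
have -> : de%:MP * F1' + (- be)%:MP * F2' = D%:MP * G1 + 0%:MP * G1 + (de * c - be * d)%:MP.
  by rewrite /F1' /F2' /D; ring.
by rewrite msize_comb_le // ltnW.
Qed.

(** * Tame automorphisms *)

Lemma tame_affine2 (phi : A -> A) : alg_endo phi -> bijective phi ->
  msize (phi X1) = 2%N -> msize (phi X2) = 2%N -> tame phi.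
Proof.
move=> h bij s1 s2; apply: tame_affine; exists (pairf (phi X1) (phi X2)).
by split; [exact: ord2P | split=> //; exact: alg_endo_pairf].
Qed.

Lemma tame_elem1 (phi : A -> A) : alg_endo phi -> bijective phi ->
  phi X2 = X2 -> tame phi.
Proof.
move=> h bij e; apply: tame_elem; exists x1, (pairf (phi X1) (phi X2)).
by split; [apply: ord2P | split=> //; exact: alg_endo_pairf].
Qed.

Lemma tame_elem2 (phi : A -> A) : alg_endo phi -> bijective phi ->
  phi X1 = X1 -> tame phi.
Proof.
move=> h bij e; apply: tame_elem; exists x2, (pairf (phi X1) (phi X2)).
by split; [apply: ord2P | split=> //; exact: alg_endo_pairf].
Qed.

Lemma tame_conj (phi tau tau' : A -> A) : tame tau -> cancel tau tau' ->
  cancel tau' tau -> tame phi <-> tame (tau \o phi \o tau').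
Proof.
move=> T K L; have T' := tame_inv T K L; split=> h.
  exact: (tame_comp (tame_comp T h) T').
apply: (tame_ext (tame_comp (tame_comp T' h) T)) => p /=.
by rewrite !K.
Qed.

(** * Exponentials of locally nilpotent derivations *)

Section Exponential.
Hypothesis hQ : forall n : nat, (n.+1%:R : R) \is a GRing.unit.
Variable d : A -> A.
Hypothesis dP : derivation d.

(** Divided powers: their Leibniz formula has no binomial coefficients and is the rule for
    multiplying polynomials. *)
Definition dpow (p : A) (k : nat) : A := ((k`!)%:R)^-1 *: iter k d p.

Lemma fact_unit k : (k`!%:R : R) \is a GRing.unit.
Proof. by rewrite -[k`!]prednK ?fact_gt0. Qed.

Lemma derivationZ c p : d (c *: p) = c *: d p.
Proof. by case: dP => dC dD dM; rewrite -!mul_mpolyC dM dC mul0r add0r. Qed.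

Lemma derivation0 : d 0 = 0.
Proof. by case: dP => dC _ _; rewrite -(mpolyC0 2) dC. Qed.

Lemma derivation_sum n (F : 'I_n -> A) : d (\sum_(i < n) F i) = \sum_(i < n) d (F i).
Proof. by case: dP => _ dD _; apply: (big_morph d dD derivation0). Qed.

Lemma iter_derivation0 k : iter k d 0 = 0.
Proof. by elim: k => //= k ->; apply: derivation0. Qed.

Lemma dpow0 p : dpow p 0 = p.
Proof. by rewrite /dpow fact0 invr1 scale1r. Qed.

Lemma dpowD p q k : dpow (p + q) k = dpow p k + dpow q k.
Proof.
rewrite /dpow -scalerDr; congr (_ *: _).
by case: dP => _ dD _; elim: k => //= k ->.
Qed.

Lemma d_dpow p k : d (dpow p k) = k.+1%:R *: dpow p k.+1.
Proof.
rewrite /dpow derivationZ scalerA; congr (_ *: _).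
by rewrite factS natrM invrM ?fact_unit // mulrC divrK.
Qed.

Lemma dpowM p q n : dpow (p * q) n = \sum_(k < n.+1) dpow p k * dpow q (n - k).
Proof.
case: (dP) => _ dD dM.
elim: n => [|n IH]; first by rewrite big_ord_recl big_ord0 !dpow0 addr0.
(* Both sides are compared after multiplication by [n.+1 = k + (n.+1 - k)]. *)
have K : cancel ( *:%R n.+1%:R) ( *:%R (n.+1%:R : R)^-1 : A -> A).
  by move=> x; rewrite scalerA mulVr ?hQ // scale1r.
apply: (can_inj K); rewrite -d_dpow IH derivation_sum.
under eq_bigr => k _ do rewrite dM !d_dpow.
rewrite big_split /= scaler_sumr.
have -> : \sum_(k < n.+2) n.+1%:R *: (dpow p k * dpow q (n.+1 - k)) =
    \sum_(k < n.+2) ((k%:R : R) *: dpow p k) * dpow q (n.+1 - k) +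
    \sum_(k < n.+2) dpow p k * ((n.+1 - k)%:R *: dpow q (n.+1 - k)).
  rewrite -big_split; apply: eq_bigr => k _ /=.
  have {1}-> : n.+1%:R = k%:R + (n.+1 - k)%:R :> R by rewrite -natrD subnKC // -ltnS.
  by rewrite scalerDl scalerAl scalerAr.
congr (_ + _).
  by rewrite [RHS]big_ord_recl mulr0n scale0r mul0r add0r;
    apply: eq_bigr => k _; rewrite lift0 subSS.
rewrite [RHS]big_ord_recr /= subnn mulr0n scale0r mulr0 addr0; apply: eq_bigr => k _ /=.
by rewrite subSn // -ltnS.
Qed.

Lemma dpowC c k : (0 < k)%N -> dpow c%:MP k = 0.
Proof.
case: dP => dC _ _; case: k => // k _.
by rewrite /dpow iterSr dC iter_derivation0 scaler0.
Qed.

(* An upper bound on the nilpotency order; it is additive under products, which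
   yields exactly the truncation bound in the definition of [expfD]. *)
Definition dorder (p : A) (n : nat) : Prop := forall k, (n < k)%N -> dpow p k = 0.

Lemma dorder_le p n m : (n <= m)%N -> dorder p n -> dorder p m.
Proof. by move=> nm o k mk; apply: o; apply: leq_ltn_trans mk. Qed.

Lemma dorderM p q n m : dorder p n -> dorder q m -> dorder (p * q) (n + m).
Proof.
move=> op oq k nmk; rewrite dpowM big1 // => i _.
have [ni|ni] := ltnP n i; first by rewrite op // mul0r.
rewrite (oq (k - i)%N) ?mulr0 // ltn_subRL; apply: leq_ltn_trans nmk.
by rewrite leq_add2r.
Qed.

Lemma dorderD p q n : dorder p n -> dorder q n -> dorder (p + q) n.
Proof. by move=> op oq k nk; rewrite dpowD op // oq // addr0. Qed.

Lemma dorderC c : dorder c%:MP 0.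
Proof. by move=> k; apply: dpowC. Qed.

Lemma dorder_sum n m (F : 'I_m -> A) : (forall i, dorder (F i) n) -> dorder (\sum_(i < m) F i) n.
Proof.
move=> oF; apply: (big_ind (fun p => dorder p n)) => // [|p q]; last exact: dorderD.
by rewrite -(mpolyC0 2); apply: dorder_le (dorderC _).
Qed.

Lemma dorderX p n k : dorder p n -> dorder (p ^+ k) (n * k).
Proof.
move=> op; elim: k => [|k IH]; first by rewrite muln0 expr0 -mpolyC1; apply: dorderC.
by rewrite exprS mulnS; apply: dorderM.
Qed.

Lemma dpow_eq0 p n k : iter n d p = 0 -> (n <= k)%N -> dpow p k = 0.
Proof.
move=> e nk; rewrite /dpow -(subnK nk) iterD e iter_derivation0.
by rewrite scaler0.
Qed.

Lemma dorder_ker p : d p = 0 -> dorder p 0.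
Proof. by move=> e k k0; apply: (@dpow_eq0 _ 1). Qed.

Lemma dorder_step p n : dorder (d p) n -> dorder p n.+1.
Proof.
move=> o [|k] //; rewrite ltnS => nk; have := o k nk.
rewrite /dpow -iterSr => /(congr1 (fun x => k`!%:R *: x)).
by rewrite scaler0 scalerA divrr ?fact_unit // scale1r => ->; rewrite scaler0.
Qed.

Variable N : A -> nat.
Hypothesis dN : forall p k, (N p <= k)%N -> dpow p k = 0.

Definition dexp (p : A) : A := \sum_(k < N p) dpow p k.

(** The truncation bound varies with the argument, so sums of different lengths must be compared.
    The coefficients of [E p] do not depend on the bound, and [dexp p] is its value at 1. *)
Let E (p : A) : {poly A} := \poly_(k < N p) dpow p k.

Let coefE p k : (E p)`_k = dpow p k.
Proof. by rewrite coef_poly; case: ltnP => // /dN ->. Qed.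

Let dexpE p : dexp p = (E p).[1].
Proof. by rewrite horner_poly; apply: eq_bigr => k _; rewrite expr1n mulr1. Qed.

Lemma dexp_step p : d (d p) = 0 -> dexp p = p + d p.
Proof.
move=> e; rewrite dexpE.
have -> : E p = p%:P + (d p)%:P * 'X.
  apply/polyP => -[|[|k]]; rewrite coefE coefD coefC coefMX coefC /=.
  - by rewrite dpow0 addr0.
  - by rewrite /dpow invr1 scale1r add0r.
  - by rewrite addr0 (@dpow_eq0 _ 2).
by rewrite !hornerE.
Qed.

Lemma dexp_ker p : d p = 0 -> dexp p = p.
Proof. by move=> e; rewrite dexp_step e ?addr0 // derivation0. Qed.

Lemma alg_endo_dexp : alg_endo dexp.
Proof.
split=> [c|p q|p q].
- by apply: dexp_ker; case: dP.
- rewrite !dexpE -hornerD; congr (_.[_]).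
  by apply/polyP => k; rewrite coefD !coefE dpowD.
- rewrite !dexpE -hornerM; congr (_.[_]).
  apply/polyP => k; rewrite coefM coefE dpowM.
  by apply: eq_bigr => i _; rewrite !coefE.
Qed.

End Exponential.

Lemma derivation_horner (d : A -> A) (G : A) (p : {poly R}) : derivation d ->
  d (horner_alg G p) = horner_alg G p^`() * d G.
Proof.
move=> dP; have [dC dD dM] := dP; elim/poly_ind: p => [|p c IH].
  by rewrite deriv0 !rmorph0 mul0r (derivation0 dP).
rewrite derivD derivC addr0 derivM derivX mulr1 !rmorphD !rmorphM /= !horner_algX.
by rewrite horner_algC alg_mpolyC dD dM dC IH; ring.
Qed.

(** * Scaling and triangular substitutions *)

Lemma mpolyX_ord2 (m : 'X_{1..2}) : 'X_[m] = X1 ^+ m x1 * X2 ^+ m x2.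
Proof.
rewrite (mpolyXE_id R m) !big_ord_recl big_ord0 mulr1.
by have -> : lift ord0 ord0 = x2 by apply: val_inj.
Qed.

Lemma sub2_scale_coef (a : R) (p : A) m :
  (sub2 X1 (a%:MP * X2) p)@_m = a ^+ m x2 * p@_m.
Proof.
elim/mpolyind: p => [|c k p _ _ IH]; first by rewrite rmorph0 !mcoeff0 mulr0.
rewrite rmorphD /= !mcoeffD mulrDr IH; congr (_ + _).
rewrite -mul_mpolyC rmorphM /= comp_mpolyC [in LHS](mpolyX_ord2 k) rmorphM !rmorphXn /=.
rewrite sub2_X1 sub2_X2 exprMn -rmorphXn /= (mulrCA _ (a ^+ _)%:MP) -mpolyX_ord2.
rewrite !mcoeffCM mcoeffX; have [->|_] := eqVneq k m; last by rewrite !mulr0.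
by rewrite mulrCA.
Qed.

Lemma sub2_triK (p : {poly R}) :
  cancel (sub2 X1 (X2 - horner_alg X1 p)) (sub2 X1 (X2 + horner_alg X1 p)).
Proof.
apply: (@alg_endo_ext (sub2 X1 (X2 + horner_alg X1 p) \o sub2 X1 (X2 - horner_alg X1 p)) id) => //.
- exact: (alg_endo_comp (alg_endo_sub2 _ _) (alg_endo_sub2 _ _)).
- by rewrite /= !sub2_X1.
- rewrite /= sub2_X2 rmorphB /= sub2_X2 (alg_endo_horner _ _ (alg_endo_sub2 _ _)) sub2_X1.
  by rewrite addrK.
Qed.

Lemma sub2_triVK (p : {poly R}) :
  cancel (sub2 X1 (X2 + horner_alg X1 p)) (sub2 X1 (X2 - horner_alg X1 p)).
Proof. by have := sub2_triK (- p); rewrite rmorphN /= opprK. Qed.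

(** * Triangular derivations and their kernel *)

Section Triangular.
Hypothesis hQ : forall n : nat, (n.+1%:R : R) \is a GRing.unit.
Variables (a : R) (b : nat -> R) (l : nat).
Hypotheses (a0 : a != 0) (bl0 : b l != 0).
Local Notation D := (Dtri a b l).

Lemma natS_neq0 (n : nat) : (n.+1%:R : R) != 0.
Proof. by apply: contraTneq (hQ n) => ->; rewrite unitr0. Qed.

Definition Bpoly : {poly R} := \poly_(i < l.+1) b i.

(* The factor [0 < i] kills the junk value of [b i.-1 / i%:R] at [i = 0]. *)
Definition Qpoly : {poly R} := \poly_(i < l.+2) (b i.-1 / i%:R *+ (0 < i)).

Lemma Qpoly0 : Qpoly`_0 = 0.
Proof. by rewrite coef_poly. Qed.

Lemma QpolyS i : Qpoly`_i.+1 = if (i <= l)%N then b i / i.+1%:R else 0.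
Proof. by rewrite coef_poly ltnS. Qed.

Lemma size_Qpoly : size Qpoly = l.+2.
Proof.
by rewrite size_poly_eq //= mulr1n mulf_neq0 // invr_eq0 natS_neq0.
Qed.

Lemma deriv_Qpoly : Qpoly^`() = Bpoly.
Proof.
apply/polyP => i; rewrite coef_deriv QpolyS coef_poly ltnS.
by case: ifP => _; rewrite ?mul0rn // -[LHS]mulr_natr divrK.
Qed.

Lemma sum_Bpoly : \sum_(i < l.+1) (b i)%:MP * X1 ^+ i = horner_alg X1 Bpoly :> A.
Proof.
rewrite /Bpoly poly_def rmorph_sum /=; apply: eq_bigr => i _.
by rewrite linearZ /= rmorphXn /= horner_algX alg_mpolyC.
Qed.

Lemma Dtri_derivation : derivation D.
Proof.
by split=> [c|p q|p q]; rewrite /Dtri ?mderivC ?mderivD ?mderivM; ring.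
Qed.

Lemma Dtri_X1 : D X1 = a%:MP.
Proof. by rewrite /Dtri !mderivU /= mul0r addr0 mul1r. Qed.

Lemma Dtri_X2 : D X2 = horner_alg X1 Bpoly.
Proof. by rewrite /Dtri !mderivU /= mul0r add0r mul1r sum_Bpoly. Qed.

Definition kernel_gen : A := a%:MP * X2 - horner_alg X1 Qpoly.
Local Notation g0 := kernel_gen.

Lemma Dtri_g0 : D g0 = 0.
Proof.
have [dC dD dM] := Dtri_derivation.
have dN p : D (- p) = - D p by rewrite -mulN1r -mpolyC1 -mpolyCN dM dC mul0r add0r mpolyCN mulN1r.
rewrite /kernel_gen dD dN dM dC (derivation_horner _ _ Dtri_derivation) deriv_Qpoly Dtri_X1 Dtri_X2.
by ring.
Qed.

(** The substitution is the triangular automorphism [x2 |-> x2 - Q(x1)] followed by [x2 |-> a x2],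
    which multiplies coefficients by powers of [a], nonzero in a domain. Thus [x1] and [g0] are
    algebraically independent. *)
Lemma sub2_g0_inj p : sub2 X1 g0 p = 0 -> p = 0.
Proof.
have -> : sub2 X1 g0 p = sub2 X1 (a%:MP * X2) (sub2 X1 (X2 - horner_alg X1 Qpoly) p).
  have H := alg_endo_comp (alg_endo_sub2 X1 (a%:MP * X2))
    (alg_endo_sub2 X1 (X2 - horner_alg X1 Qpoly)).
  rewrite -[RHS]/((_ \o _) p); apply: alg_endo_ext => //=; first exact: alg_endo_sub2.
    by rewrite !sub2_X1.
  by rewrite !sub2_X2 rmorphB /= sub2_X2 (alg_endo_horner _ _ (alg_endo_sub2 _ _)) sub2_X1.
move=> e; apply: (can_inj (sub2_triK Qpoly)); rewrite rmorph0.
apply/mpolyP => m; have := congr1 (mcoeff m) e.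
rewrite sub2_scale_coef !mcoeff0 => /eqP; rewrite mulf_eq0 expf_eq0 (negbTE a0) andbF /=.
by move/eqP.
Qed.

(** As [a x2 = g0 + Q(x1)], every polynomial is one in [x1], [g0] once [a] is inverted; the power of
    [a] clears denominators without leaving [R]. *)
Lemma sub2_g0_surj f : exists N h, (a ^+ N)%:MP * f = sub2 X1 g0 h.
Proof.
elim/mpoly_alg_ind: f => [c|i|p q [n [h eh]] [m [k ek]]|p q [n [h eh]] [m [k ek]]].
- by exists 0%N, c%:MP; rewrite comp_mpolyC expr0 mpolyC1 mul1r.
- elim/ord2P: i.
    by exists 0%N, X1; rewrite sub2_X1 expr0 mpolyC1 mul1r.
  exists 1%N, (X2 + horner_alg X1 Qpoly).
  rewrite rmorphD /= sub2_X2 (alg_endo_horner _ _ (alg_endo_sub2 _ _)) sub2_X1.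
  by rewrite /kernel_gen expr1 subrK.
- exists (n + m)%N, ((a ^+ m)%:MP * h + (a ^+ n)%:MP * k).
  rewrite rmorphD !rmorphM /= !comp_mpolyC -eh -ek exprD; by ring.
- by exists (n + m)%N, (h * k); rewrite rmorphM /= -eh -ek exprD; ring.
Qed.

Lemma mderiv1_eq0 (g : A) : mderiv x1 g = 0 -> exists q : {poly R}, g = horner_alg X2 q.
Proof.
move=> e; have S := alg_endo_sub2 X2 X1.
have : mderiv x2 (sub2 X2 X1 g) = 0.
  rewrite (chain_rule _ (mderiv_derivation x2) S) e rmorph0 sub2_X2 !mderivU /=.
  by rewrite mul0r mulr0 addr0.
case/(mderiv2_eq0 natS_neq0) => q eq; exists q.
by rewrite -[g]sub2_swapK eq (alg_endo_horner _ _ S) sub2_X1.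
Qed.

(** In the coordinates [x1], [g0] the derivation is [a] times the partial derivative in [x1], so
    [x1] does not occur in an element of the kernel. *)
Lemma Dtri_kernel f : D f = 0 -> exists N h, (a ^+ N)%:MP * f = horner_alg g0 h.
Proof.
move=> Df; have [N [h eh]] := sub2_g0_surj f; exists N.
have [dC dD dM] := Dtri_derivation.
have := chain_rule h Dtri_derivation (alg_endo_sub2 X1 g0).
rewrite -eh dM dC Df sub2_X1 sub2_X2 Dtri_g0 Dtri_X1 mul0r !mulr0 !addr0 => /esym/eqP.
rewrite mulf_eq0 mpolyC_eq0 (negbTE a0) orbF => /eqP/sub2_g0_inj/mderiv1_eq0[q eq].
by exists q; rewrite eh eq (alg_endo_horner _ _ (alg_endo_sub2 _ _)) sub2_X2.
Qed.

Lemma aXn_neq0 N : a ^+ N != 0. Proof. by rewrite expf_neq0. Qed.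

Lemma kernel_nonconst f N h (g : A) : ~ (exists c : R, f = c%:MP) ->
  (a ^+ N)%:MP * f = horner_alg g h -> (1 < size h)%N.
Proof.
move=> nc e; rewrite ltnNge; apply/negP => /size1_polyC eh; apply: nc; exists f@_0%MM.
apply: msize1_polyC; rewrite -(msizeCM _ (aXn_neq0 N)) e eh horner_algC alg_mpolyC.
exact: msizeC_le1.
Qed.

Section Exp.
Variable f : A.
Hypothesis Df : D f = 0.
Local Notation Delta := (fun q => f * D q).

Lemma Delta_derivation : derivation Delta.
Proof.
have [dC dD dM] := Dtri_derivation.
by split=> [c|p q|p q]; rewrite ?dC ?mulr0 ?dD ?dM //; ring.
Qed.

(** Weights 1 for [x1] and [l.+1] for [x2] bound the nilpotency order: [a f] lies in the kernel, and
    [f B(x1)] has order at most [l]. *)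
Lemma dorder_Delta p : dorder Delta p (l.+1 * msize p).
Proof.
have dP := Delta_derivation.
have o1 : dorder Delta X1 1.
  apply: dorder_step => //; rewrite Dtri_X1; apply: (@dorderM hQ _ dP _ _ 0 0).
    by apply: dorder_ker => //; rewrite Df mulr0.
  exact: dorderC.
have o2 : dorder Delta X2 l.+1.
  apply: dorder_step => //; rewrite Dtri_X2; apply: (@dorderM hQ _ dP _ _ 0 l).
    by apply: dorder_ker => //; rewrite Df mulr0.
  rewrite -sum_Bpoly; apply: dorder_sum => // i; apply: (@dorder_le _ _ (0 + 1 * i)).
    by rewrite add0n mul1n -ltnS.
  by apply: dorderM => //; [exact: dorderC | apply: dorderX].
rewrite {1}(mpolyE p) big_seq.
apply: (big_ind (fun q => dorder Delta q _)) => [|q r|m mp].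
- by rewrite -(mpolyC0 2); apply: dorder_le (dorderC _ _).
- exact: dorderD.
have le : (m x1 + l.+1 * m x2 <= l.+1 * msize p)%N.
  have : (m x1 + m x2 <= msize p)%N.
    have := msize_mdeg_lt mp; rewrite mdegE !big_ord_recl big_ord0 addn0.
    by have -> : lift ord0 ord0 = x2 by [apply: val_inj]; move/ltnW.
  by move=> h; apply: leq_trans (leq_mul (leqnn _) h); rewrite mulnDr leq_add2r leq_pmull.
apply: dorder_le le _; rewrite -mul_mpolyC -[(_ + _)%N]add0n; apply: dorderM => //.
  exact: dorderC.
rewrite mpolyX_ord2; apply: dorderM => //; last by apply: dorderX.
by rewrite -[X in dorder _ _ X]mul1n; apply: dorderX.
Qed.

Let dN p k : (((l.+1) * msize p).+1 <= k)%N -> dpow Delta p k = 0.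
Proof. exact: dorder_Delta. Qed.

Lemma expfD_alg : alg_endo (expfD a b l f).
Proof. exact: (alg_endo_dexp hQ Delta_derivation dN). Qed.

Lemma expfD_ker p : D p = 0 -> expfD a b l f p = p.
Proof. by move=> e; apply: (dexp_ker Delta_derivation dN); rewrite e mulr0. Qed.

Lemma expfD_X1 : expfD a b l f X1 = X1 + a%:MP * f.
Proof.
rewrite (mulrC _ f) -Dtri_X1; apply: (dexp_step Delta_derivation dN).
have [dC dD dM] := Dtri_derivation.
by rewrite Dtri_X1 dM dC Df mul0r mulr0 addr0 mulr0.
Qed.

Lemma expfD_X2 : a%:MP * expfD a b l f X2 = g0 + horner_alg (X1 + a%:MP * f) Qpoly.
Proof.
have H := expfD_alg; have [fC fD fM] := H; have := expfD_ker Dtri_g0.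
rewrite {1}/kernel_gen (alg_endoB _ _ H) fM fC (alg_endo_horner _ _ H) expfD_X1 => <-.
by rewrite subrK.
Qed.

End Exp.
End Triangular.

Lemma alg_endo_cancel (s s' : A -> A) : alg_endo s -> alg_endo s' ->
  s' (s X1) = X1 -> s' (s X2) = X2 -> cancel s s'.
Proof.
by move=> S S' e1 e2; apply: (@alg_endo_ext (s' \o s) id); rewrite //; apply: alg_endo_comp.
Qed.

(** An injective map fixing constants cannot send a variable to a constant. This is the lower bound
    in the requirement of [affine_aut] that sizes be exactly 2. *)
Lemma alg_endo_X_nonconst (phi : A -> A) i : alg_endo phi -> bijective phi ->
  (1 < msize (phi 'X_i))%N.
Proof.
move=> h [psi K _]; rewrite ltnNge; apply/negP => /msize1_polyC e.
have [fC _ _] := h; rewrite -fC in e; have := congr1 psi e; rewrite !K.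
move/(congr1 (fun p : A => msize p)).
by rewrite msize_U => e2; have := msizeC_le1 (phi 'X_i)@_0; rewrite -e2.
Qed.

(** * Shears *)

Section Shear.
Hypothesis hQ : forall n : nat, (n.+1%:R : R) \is a GRing.unit.
Variables (a b0 : R) (f : A) (N : nat) (h : {poly R}).
Hypotheses (a0 : a != 0)
  (ef : (a ^+ N)%:MP * f = horner_alg (a%:MP * X2 - b0%:MP * X1) h).

(** The form [a x2 - b0 x1] changes by [(a v - b0 u) f = 0]; hence [a ^+ N f] is fixed, and [f] with
    it. *)
Let shear_fix (u v : R) : a * v = b0 * u ->
  sub2 (X1 + u%:MP * f) (X2 + v%:MP * f) f = f.
Proof.
move=> e; set s := comp_mpoly _.
have S : alg_endo s by apply: alg_endo_sub2.
have aN : (a ^+ N)%:MP != 0 :> A by rewrite mpolyC_eq0 expf_neq0.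
apply: (mulfI aN); have := congr1 s ef; have [fC fD fM] := S.
rewrite fM fC (alg_endo_horner _ _ S) => ->; rewrite ef; congr (horner_alg _ h).
rewrite (alg_endoB _ _ S) !fM !fC /s sub2_X1 sub2_X2.
have E : a%:MP * v%:MP = b0%:MP * u%:MP :> A by rewrite -!mpolyCM e.
by rewrite !mulrDr !mulrA E; ring.
Qed.

Let shearK (u v : R) : a * v = b0 * u ->
  cancel (sub2 (X1 + u%:MP * f) (X2 + v%:MP * f)) (sub2 (X1 + (- u)%:MP * f) (X2 + (- v)%:MP * f)).
Proof.
move=> e; have F : sub2 (X1 + (- u)%:MP * f) (X2 + (- v)%:MP * f) f = f.
  by apply: shear_fix; rewrite !mulrN e.
apply: alg_endo_cancel; rewrite ?sub2_X1 ?sub2_X2 ?rmorphD ?rmorphM /= ?comp_mpolyC;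
  try exact: alg_endo_sub2.
- by rewrite sub2_X1 F; ring.
- by rewrite sub2_X2 F; ring.
Qed.

Local Notation shear := (sub2 (X1 + a%:MP * f) (X2 + b0%:MP * f)).

Lemma shear_bij : bijective shear.
Proof.
exists (sub2 (X1 + (- a)%:MP * f) (X2 + (- b0)%:MP * f)).
  by apply: shearK; rewrite mulrC.
have := @shearK (- a) (- b0); rewrite !opprK; apply.
by rewrite !mulrN mulrC.
Qed.

Let shear_alg : alg_endo shear.
Proof. exact: alg_endo_sub2. Qed.

Lemma tame_shear0 : b0 = 0 -> tame shear.
Proof.
move=> e; apply: tame_elem1; [exact: shear_alg | exact: shear_bij |].
by rewrite sub2_X2 e mul0r addr0.
Qed.

Lemma tame_shear_affine : (msize f <= 2)%N -> tame shear.
Proof.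
move=> f2; have B := shear_bij.
have le (p : A) (c : R) : (msize p <= 2)%N -> (msize (p + c%:MP * f) <= 2)%N.
  by move=> p2; rewrite msize_leD // (leq_trans (msizeCM_le _ _)).
apply: tame_affine2 => //; apply/eqP; rewrite eqn_leq alg_endo_X_nonconst // andbT.
  by rewrite sub2_X1 le // msize_U.
by rewrite sub2_X2 le // msize_U.
Qed.

Lemma tame_shear_V : inV b0 a -> tame shear.
Proof.
case=> [al [be [al0 be0 eab [s [t est]]]]]; have B := shear_bij.
(* The form [be x2 - al x1] is invariant under the shear because [be b0 = al a]. The relation
   [s al + t be = 1] completes it to linear coordinates of determinant 1, in which the shear changes
   only the first. *)
pose lam := sub2 (t%:MP * X1 + s%:MP * X2 + 0%:MP) ((- al)%:MP * X1 + be%:MP * X2 + 0%:MP) : A -> A.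
pose lam' := sub2 (be%:MP * X1 + (- s)%:MP * X2 + 0%:MP) (al%:MP * X1 + t%:MP * X2 + 0%:MP) : A -> A.
have L : alg_endo lam by apply: alg_endo_sub2.
have L' : alg_endo lam' by apply: alg_endo_sub2.
have est' : s%:MP * al%:MP + t%:MP * be%:MP = 1 :> A by rewrite -!mpolyCM -mpolyCD est.
have K : cancel lam lam'.
  apply: alg_endo_cancel => //; have [fC fD fM] := L'.
    by rewrite /lam sub2_X1 !fD !fM !fC /lam' sub2_X1 sub2_X2 -[RHS]mul1r -est'; ring.
  by rewrite /lam sub2_X2 !fD !fM !fC /lam' sub2_X1 sub2_X2 -[RHS]mul1r -est'; ring.
have K' : cancel lam' lam.
  apply: alg_endo_cancel => //; have [fC fD fM] := L.
    by rewrite /lam' sub2_X1 !fD !fM !fC /lam sub2_X1 sub2_X2 -[RHS]mul1r -est'; ring.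
  by rewrite /lam' sub2_X2 !fD !fM !fC /lam sub2_X1 sub2_X2 -[RHS]mul1r -est'; ring.
have T' : tame lam'.
  apply: tame_affine2 => //; first by exists lam.
    by rewrite /lam' sub2_X1 msize_lin // be0.
  by rewrite /lam' sub2_X2 msize_lin // al0.
apply/(tame_conj _ T' K' K); apply: tame_elem1.
- exact: (alg_endo_comp (alg_endo_comp L' shear_alg) L).
- have bL : bijective lam by exists lam'.
  have bL' : bijective lam' by exists lam.
  exact: (bij_comp (bij_comp bL' B) bL).
rewrite /= -[RHS]K; congr (lam' _); rewrite /lam sub2_X2.
rewrite !rmorphD !rmorphM /= !comp_mpolyC sub2_X1 sub2_X2.
have E : be%:MP * b0%:MP = al%:MP * a%:MP :> A by rewrite -!mpolyCM mulrC eab mulrC.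
by rewrite !mulrDr !mulrA E; ring.
Qed.

Lemma tame_shear_inV : b0 != 0 -> (2 < msize f)%N -> tame shear -> inV b0 a.
Proof.
move=> b00 f2 /(tame_reduced (natS_neq0 hQ))[_]; rewrite sub2_X1 sub2_X2 => r.
have eM (p : A) (c : R) : (msize p <= 2)%N -> c != 0 -> msize (p + c%:MP * f) = msize f.
  by move=> p2 c0; rewrite addrC msizeD_lt msizeCM // (leq_ltn_trans p2).
have := reduced_row r; rewrite !eM ?msize_U // maxnn => /(_ f2)[u [v [u' [v' [e lt]]]]].
(* The part of [u F1 + v F2] of degree above 1 comes from [(u a + v b0) f], so a drop in degree
   forces this coefficient to vanish. *)
have uv : u * a + v * b0 = 0.
  apply/eqP/negPn/negP => n0; move: lt.
  have -> : u%:MP * (X1 + a%:MP * f) + v%:MP * (X2 + b0%:MP * f)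
      = (u%:MP * X1 + v%:MP * X2 + 0%:MP) + (u * a + v * b0)%:MP * f by ring.
  by rewrite eM ?ltnn // msize_comb_le // msize_U.
have u0 : u != 0.
  apply/eqP => u0; move: uv; rewrite u0 mul0r add0r => /eqP.
  rewrite mulf_eq0 (negbTE b00) orbF => /eqP v0; move/eqP: e.
  by rewrite u0 v0 !mulr0 addr0 eq_sym oner_eq0.
have v0 : v != 0.
  by apply/eqP => v0; move/eqP: uv; rewrite v0 mul0r addr0 mulf_eq0 (negbTE u0) (negbTE a0).
exists (- u), v; split => //; first by rewrite oppr_eq0.
  by apply/eqP; rewrite mulrN -subr_eq0 opprK addrC (mulrC a) (mulrC b0) uv.
by exists (- u'), v'; rewrite mulrNN.
Qed.

(** The linear form has degree 1 because [a] is nonzero. The same [h] describes the kernel element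
    before conjugation, which ties this degree to its degree in [x2]. *)
Lemma msize_shear : (1 < size h)%N -> msize f = size h.
Proof.
move=> h1; have h0 : h != 0 by rewrite -size_poly_gt0 ltnW.
rewrite -(msizeCM _ (expf_neq0 N a0)) ef.
have -> : a%:MP * X2 - b0%:MP * X1 = (- b0)%:MP * X1 + a%:MP * X2 + 0%:MP by ring.
have m2 : msize ((- b0)%:MP * X1 + a%:MP * X2 + 0%:MP) = 2%N by rewrite msize_lin // a0 orbT.
by rewrite msize_horner ?m2 //= muln1 prednK // ltnW.
Qed.

End Shear.

(** * The degree in [x2] *)

Lemma deg_x2_mderiv_const (p : A) (c : R) : (forall n : nat, (n.+1%:R : R) != 0) ->
  c != 0 -> mderiv x2 p = c%:MP -> deg_x2 p = 1%N.
Proof.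
move=> h0 c0 e.
have co (m : 'X_{1..2}) : p@_(m + U_(x2)) *+ (m x2).+1 = c * (m == 0%MM)%:R.
  by rewrite -mcoeff_mderiv e mcoeffC.
apply/eqP; rewrite eqn_leq /deg_x2; apply/andP; split.
  apply/bigmax_leqP_seq => m mp _; rewrite leqNgt; apply/negP => m2.
  have em : m = (m - U_(x2) + U_(x2))%MM by rewrite submK // lep1mP -lt0n ltnW.
  have := co (m - U_(x2))%MM; rewrite -em.
  have -> : ((m - U_(x2))%MM == 0%MM) = false.
    apply/eqP => /(congr1 (fun m : 'X_{1..2} => m x2)); rewrite mnmBE mnm1E mnm0E eqxx.
    by apply/eqP; rewrite -lt0n subn_gt0.
  rewrite mulr0 => /eqP; rewrite -mulr_natr mulf_eq0 (negbTE (h0 _)) orbF.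
  by apply/negP; rewrite mcoeff_msupp in mp.
have U : U_(x2)%MM \in msupp p.
  have := co 0%MM; rewrite add0m mnm0E eqxx mulr1 mulr1n => ep.
  by rewrite mcoeff_msupp ep.
have := @leq_bigmax_seq _ (msupp p) xpredT (fun m : 'X_{1..2} => m x2) _ U isT.
by rewrite mnm1E eqxx.
Qed.

Lemma deg_x2_le1_mderiv2 (p : A) : (deg_x2 p <= 1)%N -> mderiv x2 (mderiv x2 p) = 0.
Proof.
move=> /bigmax_leqP_seq h; apply/mpolyP => m; rewrite !mcoeff_mderiv mcoeff0.
rewrite memN_msupp_eq0 ?mul0rn //; apply/negP => /h/(_ isT).
by rewrite !mnmDE !mnm1E eqxx !addn1.
Qed.

(** * Necessary divisibility and reduction to shears *)

Section Main.
Hypothesis hQ : forall n : nat, (n.+1%:R : R) \is a GRing.unit.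
Variables (a : R) (b : nat -> R) (l : nat) (f : A).
Hypotheses (a0 : a != 0) (bl0 : b l != 0).
Hypothesis Df : Dtri a b l f = 0.
Hypothesis fNC : ~ (exists c : R, f = c%:MP).
Local Notation Q := (Qpoly b l).
Local Notation phi := (expfD a b l f).
Local Notation g0 := (kernel_gen a b l).

Let n0 := natS_neq0 hQ.

Lemma mderiv2_g0 : mderiv x2 g0 = a%:MP.
Proof.
rewrite /kernel_gen mderivB mderivM mderivC (derivation_horner _ _ (mderiv_derivation x2)).
by rewrite !mderivU /=; ring.
Qed.

Lemma msize_g0_gt1 : (1 < msize g0)%N.
Proof.
rewrite ltnNge; apply/negP => /msize1_polyC e; have := mderiv2_g0; rewrite e mderivC.
by move/esym/eqP; rewrite mpolyC_eq0; apply/negP.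
Qed.

(** As a polynomial in [x2], [g0] has degree 1 and leading coefficient [a], so [f] has the degree of
    [h]; degree one is detected by derivatives in [x2]. *)
Lemma deg_x2_kernel N h : (a ^+ N)%:MP * f = horner_alg g0 h -> (1 < size h)%N ->
  deg_x2 f = 1%N <-> size h = 2%N.
Proof.
move=> e h1; have dP := mderiv_derivation x2; have aN0 := aXn_neq0 a0 N.
split=> [d1|h2].
  apply/eqP; rewrite eqn_leq h1 andbT; apply/leq_sizeP => -[|[|j]] // _.
  (* The second derivative of [h(g0)] is [a ^+ 2 h''(g0)], so [h'' = 0]. *)
  have := congr1 (fun p => mderiv x2 (mderiv x2 p)) e => /=.
  rewrite !mderivM !mderivC !mul0r !add0r mderivM mderivC mul0r add0r.
  rewrite deg_x2_le1_mderiv2 ?d1 // mulr0.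
  rewrite (derivation_horner _ _ dP) mderivM (derivation_horner _ _ dP) mderiv2_g0 mderivC.
  rewrite mulr0 addr0.
  move/esym/eqP; rewrite !mulf_eq0 !mpolyC_eq0 (negbTE a0) !orbF => /eqP h3.
  have : h^`()^`() == 0.
    apply: contraTT isT => nz; have := msize_horner msize_g0_gt1 nz.
    by rewrite h3 mmeasure0.
  move/eqP/(congr1 (fun p : {poly R} => p`_j)); rewrite !coef_deriv coef0 => /eqP.
  by rewrite -!(mulr_natr (_ *+ _)) -!(mulr_natr h`_ _) !mulf_eq0 !(negbTE (n0 _)) !orbF => /eqP.
have : (a ^+ N)%:MP * mderiv x2 f = (h`_1 * a)%:MP.
  have := congr1 (mderiv x2) e; rewrite horner_alg_lin ?h2 // mderivM mderivC mul0r add0r => ->.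
  by rewrite mderivD mderivM !mderivC mderiv2_g0; ring.
move=> e2; have h10 : h`_1 != 0.
  by have : lead_coef h != 0; [rewrite lead_coef_eq0 -size_poly_gt0 h2 | rewrite lead_coefE h2].
have /msize1_polyC ec : (msize (mderiv x2 f) <= 1)%N.
  by rewrite -(msizeCM _ aN0) e2 msizeC_le1.
apply: (deg_x2_mderiv_const n0 _ ec); apply/negP => /eqP z; move: e2; rewrite ec z mpolyC0 mulr0.
by move/esym/eqP; rewrite mpolyC_eq0 mulf_eq0 (negbTE a0) (negbTE h10).
Qed.

Lemma tame_dvd_coef : tame phi -> forall i, (1 <= i <= l)%N -> in_aR a (b i).
Proof.
move=> /(tame_reduced n0)[H r] [|i] // /andP[_ il].
have l0 : (0 < l)%N by apply: leq_trans il.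
have [N [h eh]] := Dtri_kernel hQ a0 Df.
have h1 := kernel_nonconst a0 fNC eh.
have sQ := size_Qpoly hQ bl0.
have Qn0 : Q != 0 by rewrite -size_poly_gt0 sQ.
have mQ : msize (horner_alg X1 Q) = l.+2.
  by rewrite msize_horner ?msize_U // sQ /= muln1.
(* Since [l] is positive, [Q(x1)] dominates [a x2] in [g0]. *)
have mg : msize g0 = l.+2.
  by rewrite /kernel_gen addrC msizeD_lt msizeN ?msizeCM // mQ msize_U.
have mf : (l.+2 <= msize f)%N.
  have hn0 : h != 0 by rewrite -size_poly_gt0 ltnW.
  rewrite -(msizeCM _ (aXn_neq0 a0 N)) eh msize_horner ?mg //= ltnS.
  by rewrite leq_pmull // -ltnS prednK // ltnW.
rewrite expfD_X1 // in r; have e2 := expfD_X2 hQ Df.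
set F1 := X1 + _ in r e2; set F2 := phi X2 in r e2.
have mF1 : msize F1 = msize f.
  by rewrite /F1 addrC msizeD_lt msizeCM // msize_U (leq_trans _ mf).
have F11 : (1 < msize F1)%N by rewrite mF1 (leq_trans _ mf).
have mQF : (msize F1 < msize (horner_alg F1 Q))%N.
  rewrite msize_horner // sQ /=; case: (msize F1) F11 l l0 => [|[|m]] // _ [|k] // _ /=.
  by rewrite 2!mulSn !addSn addnS !ltnS leq_addr.
have mF2 : msize F2 = msize (horner_alg F1 Q).
  rewrite -(msizeCM _ a0) e2 addrC msizeD_lt // mg.
  by apply: leq_ltn_trans mQF; rewrite mF1.
have lt : (msize F1 < msize F2)%N by rewrite mF2.
have [p mp] := reduced_sub_horner r lt.
(* [Q(F1) - a p(F1)] equals [a (F2 - p(F1)) - g0], and the degree of [g0] is at most that of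
   [F1]. *)
have le : (msize (horner_alg F1 (Q - a%:P * p)) <= msize F1)%N.
  have -> : horner_alg F1 (Q - a%:P * p) = a%:MP * (F2 - horner_alg F1 p) - g0.
    by rewrite rmorphB rmorphM /= horner_algC alg_mpolyC mulrBr e2; ring.
  rewrite msize_leD ?msizeN ?mg ?mF1 //.
  by rewrite (leq_trans (msizeCM_le _ _)) // -mF1.
(* A polynomial of degree at least 2 would raise the degree of [F1]. *)
have s2 : (size (Q - a%:P * p)%R <= 2)%N.
  rewrite leqNgt; apply/negP => s3; move: le.
  rewrite msize_horner //; last by rewrite -size_poly_gt0 ltnW // ltnW.
  case: (msize F1) (size _) F11 s3 => [|[|m]] [|[|[|k]]] // _ _ /=.
  by rewrite leqNgt 2!mulSn !addSn addnS !ltnS leq_addr.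
(* The coefficient of [Q] in degree [i.+2] is [b i.+1 / i.+2], whose denominator is a unit. *)
have := (leq_sizeP _ _ s2) i.+2 isT; rewrite coefB coefCM QpolyS il => /eqP.
rewrite subr_eq0 => /eqP e; exists (p`_i.+2 * i.+2%:R).
by rewrite mulrA -e divrK // hQ.
Qed.

Lemma all_in_aR_poly (q : {poly R}) : (forall i, in_aR a q`_i) ->
  exists P : {poly R}, q = a%:P * P.
Proof.
elim/poly_ind: q => [|q c IH] h; first by exists 0; rewrite mulr0.
have [i|P ->] := IH; first by have := h i.+1; rewrite coefD coefMX coefC /= addr0.
have [d ed] := h 0%N; rewrite coefD coefMX coefC /= add0r in ed.
by exists (P * 'X + d%:P); rewrite ed polyCM; ring.
Qed.

(** Integration divides only by units, so divisibility by [a] passes from the [b i] to [Q]. The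
    choice is [c = 0] if [a] divides [b 0], and [c = b 0] otherwise. *)
Lemma Qpoly_split (c : R) : in_aR a (b 0%N - c) ->
  (forall i, (0 < i <= l)%N -> in_aR a (b i)) ->
  exists P : {poly R}, Q = a%:P * P + c%:P * 'X.
Proof.
move=> h0 hi; have [|P eP] := @all_in_aR_poly (Q - c%:P * 'X); last first.
  by exists P; rewrite -eP subrK.
have in0 : in_aR a 0 by exists 0; rewrite mulr0.
move=> [|[|i]]; rewrite coefB coefCM coefX ?Qpoly0 ?QpolyS /= ?mulr0 ?mulr1 ?subr0 //.
  by rewrite divr1.
case: ifP => // il; have [|d ->] := hi i.+1; first by rewrite il.
by exists (d / i.+2%:R); rewrite mulrA.
Qed.

(* Conjugation by [x2 |-> x2 + P(x1)] turns [Dtri a b l] into the derivation with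
   constant coefficients [x1 |-> a], [x2 |-> b0]. *)
Lemma tame_iff_shear (P : {poly R}) (b0 : R) : Q = a%:P * P + b0%:P * 'X ->
  let f' := sub2 X1 (X2 + horner_alg X1 P) f in
  (tame phi <-> tame (sub2 (X1 + a%:MP * f') (X2 + b0%:MP * f'))) /\
  forall N h, (a ^+ N)%:MP * f = horner_alg g0 h ->
    (a ^+ N)%:MP * f' = horner_alg (a%:MP * X2 - b0%:MP * X1) h.
Proof.
move=> eQ f'; pose tau := sub2 X1 (X2 + horner_alg X1 P) : A -> A.
pose tau' := sub2 X1 (X2 - horner_alg X1 P) : A -> A.
have T : alg_endo tau by apply: alg_endo_sub2.
have T' : alg_endo tau' by apply: alg_endo_sub2.
have K : cancel tau tau' by apply: sub2_triVK.
have K' : cancel tau' tau by apply: sub2_triK.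
have tT : tame tau by apply: tame_elem2 => //; [exists tau' | rewrite /tau sub2_X1].
have H := expfD_alg hQ Df.
have eQ1 (G : A) : horner_alg G Q = a%:MP * horner_alg G P + b0%:MP * G.
  by rewrite eQ rmorphD !rmorphM /= !horner_algC horner_algX !alg_mpolyC.
have [tC tD tM] := T; have [fC fD fM] := H.
split; last first.
  move=> N h e; rewrite -/(tau f) in f' *; rewrite /f' -tC -tM e (alg_endo_horner _ _ T).
  congr (horner_alg _ h); rewrite /kernel_gen eQ1 (alg_endoB _ _ T) tD.
  rewrite !tM !tC (alg_endo_horner _ _ T).
  by rewrite /tau sub2_X1 sub2_X2; ring.
have E : tau \o phi \o tau' =1 sub2 (X1 + a%:MP * f') (X2 + b0%:MP * f').
  apply: alg_endo_ext.
  - exact: (alg_endo_comp (alg_endo_comp T H) T').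
  - exact: alg_endo_sub2.
  - by rewrite /= [tau' _]sub2_X1 expfD_X1 // tD tM tC [tau X1]sub2_X1 sub2_X1.
  rewrite /= [tau' _]sub2_X2 sub2_X2 (alg_endoB _ _ H) (alg_endo_horner _ _ H) expfD_X1 //.
  have aP0 : a%:MP != 0 :> A by rewrite mpolyC_eq0.
  (* [phi X2] is known through its multiple by [a], a factor cancelled afterwards. *)
  have E2 : a%:MP * (phi X2 - horner_alg (X1 + a%:MP * f) P) =
      a%:MP * (X2 - horner_alg X1 P) + b0%:MP * a%:MP * f.
    by rewrite mulrBr expfD_X2 // eQ1 /kernel_gen eQ1; ring.
  apply: (mulfI aP0); have := congr1 tau E2; rewrite tM tC => ->.
  rewrite tD !tM !tC (alg_endoB _ _ T) (alg_endo_horner _ _ T) [tau X1]sub2_X1 [tau X2]sub2_X2.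
  by rewrite -/(tau f) -/f'; ring.
split=> h.
  exact: (tame_ext (proj1 (tame_conj _ tT K K') h) E).
exact: (proj2 (tame_conj _ tT K K') (tame_ext h (fsym E))).
Qed.

End Main.

End TwoVariables.

(** * The tameness criterion and the case [V(R) = K^x] *)

Local Notation sub2 F1 F2 := (comp_mpoly [tuple F1; F2]).

Theorem theorem3p2p2 (R : idomainType)
  (hQ : forall n : nat, ((n.+1)%:R : R) \is a GRing.unit)
  (l : nat) (a : R) (b : nat -> R) (f : {mpoly R[2]}) :
  a != 0 -> b l != 0 ->
  Dtri a b l f = 0 -> ~ (exists c : R, f = c%:MP) ->
  (tame (expfD a b l f) <->
     ((forall i, (i <= l)%N -> in_aR a (b i)) \/
      [/\ ~ in_aR a (b 0%N),
          (forall i, (0 < i <= l)%N -> in_aR a (b i)) &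
          (inV (b 0%N) a \/ deg_x2 f = 1%N)]))
  /\
  (V_is_Kx R ->
     ((tame (expfD a b l f)) <-> (forall i, (1 <= i <= l)%N -> in_aR a (b i)))).
Proof.
move=> a0 bl0 Df fNC.
have [N [h eh]] := Dtri_kernel hQ a0 Df.
have h1 := kernel_nonconst a0 fNC eh.
have deg2 := deg_x2_kernel hQ a0 eh h1.
have dvdP : tame (expfD a b l f) -> forall i, (1 <= i <= l)%N -> in_aR a (b i).
  exact: tame_dvd_coef.
have main : tame (expfD a b l f) <->
     ((forall i, (i <= l)%N -> in_aR a (b i)) \/
      [/\ ~ in_aR a (b 0%N),
          (forall i, (0 < i <= l)%N -> in_aR a (b i)) &
          (inV (b 0%N) a \/ deg_x2 f = 1%N)]).
  split=> [T|[dv|[nb0 dv VD]]].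
  - have dv := dvdP T; have [ab0|nb0] := classic (in_aR a (b 0%N)).
      by left=> -[|i] // il; apply: dv.
    right; split=> //.
    have [|P eP] := @Qpoly_split _ a b l (b 0%N) _ dv; first by exists 0; rewrite subrr mulr0.
    have [/proj1/(_ T) T' /(_ N h eh) eh'] := tame_iff_shear hQ a0 Df eP.
    have b00 : b 0%N != 0 by apply/eqP => b00; apply: nb0; exists 0; rewrite b00 mulr0.
    (* The degree of the conjugated [f] selects the alternative: degree one gives [deg_x2 f = 1], a
       higher degree gives the unimodular row. *)
    have [f2|f2] := leqP (msize (sub2 'X_x1 ('X_x2 + horner_alg 'X_x1 P) f)) 2.
      right; apply/deg2/eqP; rewrite eqn_leq h1 andbT.
      by rewrite -(msize_shear a0 eh').
    by left; apply: tame_shear_inV T'.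
  (* With all coefficients divisible by [a], the shear has zero second component and is
     elementary. *)
  - have [||P eP] := @Qpoly_split _ a b l 0.
    + by rewrite subr0; apply: dv.
    + by move=> i /andP[_ il]; apply: dv.
    have [E /(_ N h eh) eh'] := tame_iff_shear hQ a0 Df eP.
    by apply/E/(tame_shear0 a0 eh').
  - have [|P eP] := @Qpoly_split _ a b l (b 0%N) _ dv; first by exists 0; rewrite subrr mulr0.
    have [E /(_ N h eh) eh'] := tame_iff_shear hQ a0 Df eP; apply/E.
    case: VD => [V|/deg2 h2]; first exact: (tame_shear_V a0 eh').
    by apply: (tame_shear_affine a0 eh'); rewrite (msize_shear a0 eh') ?h2.
split=> // VK; split=> [|dv]; first exact: dvdP.
apply/main; have [ab0|nb0] := classic (in_aR a (b 0%N)).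
  by left=> -[|i] // il; apply: dv.
(* [b 0] is nonzero because 0 lies in [aR], so the hypothesis on [V(R)] applies to [b 0 / a]. *)
right; split=> //; left; apply: VK => //.
by apply/eqP => b00; apply: nb0; exists 0; rewrite b00 mulr0.
Qed.
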